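(* Let $l>0$, $g>0$ and let $f\colon[0,\infty)\to\mathbb{R}$ be a smooth function. Consider the system $$\dot\varphi = p,\qquad \dot p = \frac{g}{l}\sin\varphi-\frac{\ddot f(t)}{l}\cos\varphi .$$ Then there exists $\varphi_0\in(-\pi/2,\pi/2)$ such that the solution of this system starting at time $t=0$ from $\varphi=\varphi_0$, $p=p_0=0$ satisfies $$-\pi/2<\varphi(t,\varphi_0,0)<\pi/2\quad\text{for all } t\in[0,\infty).$$
   Context: The system describes an inverted planar pendulum of length $l$ (massless rod, point mass at its end) under gravity with gravitational constant $g$, whose pivot point moves along a horizontal line according to the law $f(t)$. The horizontal positions of the rod are $\varphi=\pm\pi/2$, and the position of the point mass is $x=f+l\sin\varphi$, $y=l\cos\varphi$. Dots denote derivatives in $t$. The variable $\varphi$ is an angle, i.e. it is taken modulo $2\pi$, so the phase space is $(\mathbb{R}/2\pi\mathbb{Z})\times\mathbb{R}$. The interval $(-\pi/2,\pi/2)$ is identified with its image in $\mathbb{R}/2\pi\mathbb{Z}$. The notation $\varphi(t,\varphi_0,p_0)$ stands for the $\varphi$-component at time $t$ of the solution with $\varphi=\varphi_0$, $p=p_0$ at time $t=0$. *)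

(* Defs.v *)
From Stdlib Require Import Reals Lra Lia ZArith.
From Stdlib Require Import FunctionalExtensionality PropExtensionality.
From Coquelicot Require Import Coquelicot.
Open Scope R_scope.

(** Functions on [0, +oo) are represented by functions on [R] of which only the
    values at nonnegative arguments are ever used. *)

Definition ray (t : R) : Prop := 0 <= t.

(** Coquelicot's [is_derive] with [locally t] replaced by its trace on the ray;
    at [t = 0] this is the right derivative. *)
Definition is_derive_ray (f : R -> R) (t d : R) : Prop :=
  filterdiff f (within ray (locally t)) (fun h => scal h d).

(** Meaningful only where the derivative exists: see [is_derive_ray_unique]. *)
Definition Derive_ray (f : R -> R) (t : R) : R := iota (is_derive_ray f t).

Definition Derive_ray_n (n : nat) (f : R -> R) : R -> R :=
  Nat.iter n Derive_ray f.

Definition smooth_ray (f : R -> R) : Prop :=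
  forall (n : nat) (t : R), 0 <= t ->
    exists d : R, is_derive_ray (Derive_ray_n n f) t d.

(** The circle [R / 2 PI Z] as the type of cosets of [2 PI Z]. *)
Definition coset (x : R) : R -> Prop :=
  fun y => exists k : Z, y = x + 2 * PI * IZR k.

Definition angle : Type := {A : R -> Prop | exists x : R, A = coset x}.

Definition ang (x : R) : angle := exist _ (coset x) (ex_intro _ x eq_refl).

(** Velocity of a curve on the circle, computed in a local lift to [R]. *)
Definition is_velocity_ray (phi : R -> angle) (t v : R) : Prop :=
  exists theta : R -> R,
    within ray (locally t) (fun s => phi s = ang (theta s)) /\
    is_derive_ray theta t v.

(** The right-hand side of the second equation is evaluated at a representative
    [x] of the angle [phi t]; its value does not depend on [x]. *)
Definition pendulum_solution (l g : R) (f : R -> R)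
    (phi : R -> angle) (p : R -> R) : Prop :=
  forall t : R, 0 <= t ->
    is_velocity_ray phi t (p t) /\
    (forall x : R, phi t = ang x ->
       is_derive_ray p t (g / l * sin x - Derive_ray_n 2 f t / l * cos x)).

(** The image in the circle of the interval of angles above the horizontal. *)
Definition upper_arc (a : angle) : Prop :=
  exists x : R, - (PI / 2) < x < PI / 2 /\ a = ang x.

Lemma ang_eq (x y : R) : ang x = ang y <-> exists k : Z, y = x + 2 * PI * IZR k.
Proof.
  split.
  - intros H.
    assert (E : coset x = coset y) by exact (f_equal (@proj1_sig _ _) H).
    change (coset x y). rewrite E. exists 0%Z. simpl. ring.
  - intros [k ->].
    assert (E : coset x = coset (x + 2 * PI * IZR k)).
    { apply functional_extensionality; intros z.
      apply propositional_extensionality; split; intros [m ->].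
      - exists (m - k)%Z. rewrite minus_IZR. ring.
      - exists (m + k)%Z. rewrite plus_IZR. ring. }
    unfold ang. revert E. generalize (x + 2 * PI * IZR k). intros y E.
    apply eq_sig_hprop; [intros; apply proof_irrelevance | exact E].
Qed.

Lemma ang_surj (a : angle) : exists x : R, a = ang x.
Proof. destruct a as [A [x ->]]. exists x. reflexivity. Qed.

Lemma is_derive_rayE (f : R -> R) (t d : R) : 0 <= t ->
  is_derive_ray f t d <->
  forall eps : R, 0 < eps -> exists delta : R, 0 < delta /\
    forall s : R, 0 <= s -> Rabs (s - t) < delta ->
      Rabs (f s - f t - (s - t) * d) <= eps * Rabs (s - t).
Proof.
  intros Ht. split.
  - intros [_ H] eps He.
    assert (L : is_filter_lim (within ray (locally t)) t)
      by (intros P HP; apply filter_le_within; exact HP).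
    destruct (H t L (mkposreal eps He)) as [delta Hd].
    exists delta. split; [apply cond_pos|].
    intros s Hs Hst. exact (Hd s Hst Hs).
  - intros H. split; [exact (is_linear_scal_l (K := R_AbsRing) (V := R_NormedModule) d)|].
    intros x Hx eps.
    assert (E : x = t).
    { destruct (Req_dec x t) as [E|N]; [exact E | exfalso].
      assert (Q : 0 < Rabs (x - t)) by (apply Rabs_pos_lt; lra).
      assert (P : 0 < Rabs (x - t) / 2) by lra.
      destruct (Hx _ (locally_ball x (mkposreal _ P))) as [r Hr].
      specialize (Hr t (ball_center t r) Ht).
      change (Rabs (t - x) < Rabs (x - t) / 2) in Hr.
      rewrite Rabs_minus_sym in Hr. lra. }
    subst x. destruct (H eps (cond_pos eps)) as [delta [Hd0 Hd]].
    exists (mkposreal delta Hd0). intros s Hst Hs. exact (Hd s Hs Hst).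
Qed.

Lemma is_derive_ray_inj (f : R -> R) (t d e : R) : 0 <= t ->
  is_derive_ray f t d -> is_derive_ray f t e -> d = e.
Proof.
  intros Ht Hd' He'.
  pose proof (proj1 (is_derive_rayE f t d Ht) Hd') as Hd.
  pose proof (proj1 (is_derive_rayE f t e Ht) He') as He.
  destruct (Req_dec d e) as [E|N]; [exact E | exfalso].
  assert (P : 0 < Rabs (d - e)) by (apply Rabs_pos_lt; lra).
  destruct (Hd (Rabs (d - e) / 4)) as [a [Ha Hda]]; [lra|].
  destruct (He (Rabs (d - e) / 4)) as [b [Hb Heb]]; [lra|].
  set (h := Rmin a b / 2).
  assert (Hh : 0 < h /\ h < a /\ h < b)
    by (unfold h, Rmin; destruct (Rle_dec a b); lra).
  assert (Eh : Rabs (t + h - t) = h)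
    by (replace (t + h - t) with h by ring; apply Rabs_pos_eq; lra).
  specialize (Hda (t + h)). specialize (Heb (t + h)).
  rewrite Eh in Hda, Heb.
  assert (A := Hda ltac:(lra) ltac:(lra)).
  assert (B := Heb ltac:(lra) ltac:(lra)).
  set (u := f (t + h) - f t - (t + h - t) * d) in A.
  set (v := f (t + h) - f t - (t + h - t) * e) in B.
  assert (C : Rabs (v - u) <= Rabs v + Rabs u).
  { unfold Rminus. rewrite <- (Rabs_Ropp u). apply Rabs_triang. }
  replace (v - u) with (h * (d - e)) in C by (unfold u, v; ring).
  rewrite Rabs_mult, (Rabs_pos_eq h) in C by lra. nra.
Qed.

Lemma is_derive_ray_unique (f : R -> R) (t d : R) : 0 <= t ->
  is_derive_ray f t d -> Derive_ray f t = d.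
Proof.
  intros Ht Hd. apply (is_derive_ray_inj f t); [exact Ht | | exact Hd].
  unfold Derive_ray. apply (iota_correct (is_derive_ray f t)).
  exists d. split; [exact Hd|].
  intros e He. exact (is_derive_ray_inj f t d e Ht Hd He).
Qed.

(* Main.v *)
Require Import Defs.
From Stdlib Require Import Reals Lra Lia ZArith Classical ClassicalEpsilon.
From Coquelicot Require Import Coquelicot.
Open Scope R_scope.

(** On the horizontal positions gravity pushes outwards: at [phi = PI/2] the
    acceleration is [g / l > 0] whatever the pivot does, so a motion that reaches
    [PI/2] from above, even with zero velocity, exceeds [PI/2] right afterwards;
    symmetrically at [- PI/2].  By continuous dependence, the initial angles in
    [[- PI/2, PI/2]] whose motion exceeds [PI/2] before reaching [- PI/2], and
    those for which the reverse happens, form disjoint open sets containing [PI/2]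
    and [- PI/2] respectively.  An interval is connected, so some initial angle,
    found as a supremum, lies in neither set; its motion never leaves the arc. *)


(** * Differential inequalities *)

Lemma ex_derive_continuous_R (h : R -> R) (t : R) : ex_derive h t -> continuous h t.
Proof. exact (@ex_derive_continuous R_AbsRing R_NormedModule h t). Qed.

Lemma derive_nonpos_le (h dh : R -> R) (s T : R) : s <= T ->
  (forall t, s <= t <= T -> continuous h t) ->
  (forall t, s < t < T -> is_derive h t (dh t) /\ dh t <= 0) ->
  h T <= h s.
Proof.
  intros HT Hc Hd.
  destruct (Req_dec T s) as [->|N]; [lra|].
  (* The intermediate point may be an endpoint, where nothing is known about [dh]; capping by 0
     keeps the sign there too. *)
  destruct (MVT_gen h s T (fun t => Rmin (dh t) 0)) as [c [Hc1 Hc2]].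
  - rewrite Rmin_left, Rmax_right by lra. intros t Ht.
    destruct (Hd t Ht) as [H1 H2]. rewrite Rmin_left; assumption.
  - rewrite Rmin_left, Rmax_right by lra. intros t Ht.
    apply continuity_pt_filterlim. exact (Hc t Ht).
  - assert (Rmin (dh c) 0 <= 0) by apply Rmin_r. nra.
Qed.

(** The product [D t * exp (- K * t)] is nonincreasing. Derivatives are asked for in the open
    interval only, because a ray function extended below 0 may fail to be differentiable at 0. *)
Lemma gronwall (D dD : R -> R) (K T : R) : 0 <= T ->
  (forall t, 0 <= t <= T -> continuous D t) ->
  (forall t, 0 < t < T -> is_derive D t (dD t) /\ dD t <= K * D t) ->
  D T <= D 0 * exp (K * T).
Proof.
  intros HT Hc Hd.
  assert (H : D T * exp (- K * T) <= D 0 * exp (- K * 0)).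
  { apply (derive_nonpos_le (fun t => D t * exp (- K * t))
      (fun t => (dD t - K * D t) * exp (- K * t)) 0 T HT).
    - intros t Ht. apply (continuous_mult D); [now apply Hc|].
      apply ex_derive_continuous_R. auto_derive. exact I.
    - intros t Ht. destruct (Hd t Ht) as [H1 H2]. split.
      + auto_derive; [now exists (dD t)|].
        rewrite (is_derive_unique (fun x : R => D x) t (dD t) H1). ring.
      + assert (0 < exp (- K * t)) by apply exp_pos. nra. }
  rewrite Rmult_0_r, exp_0, Rmult_1_r in H.
  assert (E : exp (- K * T) * exp (K * T) = 1).
  { rewrite <- exp_plus. replace (- K * T + K * T) with 0 by ring. apply exp_0. }
  assert (P : 0 < exp (K * T)) by apply exp_pos.
  replace (D T) with (D T * exp (- K * T) * exp (K * T)) by (rewrite Rmult_assoc, E; ring).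
  apply Rmult_le_compat_r; lra.
Qed.

Lemma exp_le (x y : R) : x <= y -> exp x <= exp y.
Proof.
  intros [H | ->]; [left; now apply exp_increasing | apply Rle_refl].
Qed.

(** The function [c / K * exp (K * t)] is an antiderivative of the bound and is nonnegative at 0, so
    it dominates both [h] and [- h]. Each integration thus gains a factor [1 / K] in the weighted
    norm. *)
Lemma exp_integral_bound (h dh : R -> R) (c K T : R) : 0 < K -> 0 <= T -> 0 <= c ->
  h 0 = 0 ->
  (forall t, 0 <= t <= T -> is_derive h t (dh t) /\ Rabs (dh t) <= c * exp (K * t)) ->
  forall t, 0 <= t <= T -> Rabs (h t) <= c / K * exp (K * t).
Proof.
  intros HK HT Hc0 H0 Hd t Ht.
  assert (cK : 0 <= c / K) by (apply Rdiv_le_0_compat; lra).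
  assert (G : forall e : R, e = 1 \/ e = -1 -> e * h t <= c / K * exp (K * t)).
  { intros e He.
    assert (H : e * h t - c / K * exp (K * t) <= e * h 0 - c / K * exp (K * 0)).
    { apply (derive_nonpos_le (fun t => e * h t - c / K * exp (K * t))
        (fun t => e * dh t - c * exp (K * t)) 0 t).
      - lra.
      - intros s Hs. apply ex_derive_continuous_R. destruct (Hd s) as [H1 _]; [lra|].
        auto_derive. now exists (dh s).
      - intros s Hs. destruct (Hd s) as [H1 H2]; [lra|]. split.
        + auto_derive; [now exists (dh s)|].
          rewrite (is_derive_unique (fun x : R => h x) s (dh s) H1). field. lra.
        + apply Rabs_le_between in H2. destruct He; subst e; lra. }
    rewrite H0, Rmult_0_r, Rmult_0_r, exp_0 in H. lra. }
  apply Rabs_le_between. pose proof (G 1). pose proof (G (-1)). lra.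
Qed.

Lemma sin_lipschitz (x y : R) : Rabs (sin x - sin y) <= Rabs (x - y).
Proof.
  rewrite <- (Rmult_1_l (Rabs (x - y))).
  apply (bounded_variation sin cos). intros t _. split.
  - auto_derive; [exact I | ring].
  - apply Rabs_le_between, COS_bound.
Qed.

Lemma cos_lipschitz (x y : R) : Rabs (cos x - cos y) <= Rabs (x - y).
Proof.
  rewrite <- (Rmult_1_l (Rabs (x - y))).
  apply (bounded_variation cos (fun t => - sin t)). intros t _. split.
  - auto_derive; [exact I | ring].
  - rewrite Rabs_Ropp. apply Rabs_le_between, SIN_bound.
Qed.

(** * Global solutions by Picard iteration *)

(** The angular acceleration, with [a] standing for g / l and [b] for the pivot acceleration divided
    by l. *)
Definition force (a : R) (b : R -> R) (t x : R) : R := a * sin x - b t * cos x.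

Lemma force_continuous (a : R) (b u : R -> R) (t : R) :
  continuous b t -> continuous u t -> continuous (fun s => force a b s (u s)) t.
Proof.
  intros Hb Hu.
  assert (cs : forall x, continuous sin x)
    by (intros x; apply ex_derive_continuous_R; auto_derive; exact I).
  assert (cc : forall x, continuous cos x)
    by (intros x; apply ex_derive_continuous_R; auto_derive; exact I).
  apply (continuous_minus (fun s => a * sin (u s)) (fun s => b s * cos (u s))).
  - apply (continuous_scal_r a (fun s => sin (u s))).
    now apply (continuous_comp u sin).
  - apply (continuous_mult b (fun s => cos (u s))); [exact Hb|].
    now apply (continuous_comp u cos).
Qed.

Lemma force_lipschitz (a B : R) (b : R -> R) (t x y : R) : 0 < a ->
  Rabs (b t) <= B -> Rabs (force a b t x - force a b t y) <= (a + B) * Rabs (x - y).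
Proof.
  intros Ha HB. unfold force.
  replace (a * sin x - b t * cos x - (a * sin y - b t * cos y))
    with (a * (sin x - sin y) + - (b t * (cos x - cos y))) by ring.
  eapply Rle_trans; [apply Rabs_triang|].
  rewrite Rabs_Ropp, !Rabs_mult, (Rabs_pos_eq a) by lra.
  pose proof (sin_lipschitz x y). pose proof (cos_lipschitz x y).
  pose proof (Rabs_pos (b t)). pose proof (Rabs_pos (cos x - cos y)). nra.
Qed.

Lemma continuous_bounded (b : R -> R) (T : R) : 0 <= T -> (forall t, continuous b t) ->
  exists B, 0 <= B /\ forall t, 0 <= t <= T -> Rabs (b t) <= B.
Proof.
  intros HT Hb.
  destruct (continuity_ab_maj (fun t => Rabs (b t)) 0 T HT) as [m [Hm _]].
  - intros t _. apply continuity_pt_filterlim.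
    apply (continuous_comp b Rabs); [apply Hb|]. apply continuous_Rabs.
  - exists (Rabs (b m)). split; [apply Rabs_pos | exact Hm].
Qed.

Definition speed (a : R) (b u : R -> R) (t : R) : R :=
  RInt (fun s => force a b s (u s)) 0 t.

(** The double integral form of the equation with initial angle [c] and initial velocity 0. Only the
    angle is iterated; the velocity of a fixed point [u] is [speed a b u]. *)
Definition picard (a : R) (b : R -> R) (c : R) (u : R -> R) (t : R) : R :=
  c + RInt (speed a b u) 0 t.

Lemma is_derive_RInt_continuous (h : R -> R) (t : R) :
  (forall s, continuous h s) -> is_derive (fun s => RInt h 0 s) t (h t).
Proof.
  intros Hh. apply (is_derive_RInt h (fun s => RInt h 0 s) 0); [|apply Hh].
  apply filter_forall. intros s. apply (RInt_correct (V := R_CompleteNormedModule)).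
  apply (ex_RInt_continuous (V := R_CompleteNormedModule)). intros; apply Hh.
Qed.

Lemma is_derive_speed (a : R) (b u : R -> R) (t : R) :
  (forall s, continuous b s) -> (forall s, continuous u s) ->
  is_derive (speed a b u) t (force a b t (u t)).
Proof.
  intros Hb Hu. apply (is_derive_RInt_continuous (fun s => force a b s (u s))).
  intros s. now apply force_continuous.
Qed.

Lemma is_derive_picard (a : R) (b : R -> R) (c : R) (u : R -> R) (t : R) :
  (forall s, continuous b s) -> (forall s, continuous u s) ->
  is_derive (picard a b c u) t (speed a b u t).
Proof.
  intros Hb Hu.
  replace (speed a b u t) with (0 + speed a b u t) by ring.
  apply (is_derive_plus (fun _ => c) (fun s => RInt (speed a b u) 0 s)).
  - apply (is_derive_const c).
  - apply is_derive_RInt_continuous. intros s. apply ex_derive_continuous_R.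
    eexists. now apply is_derive_speed.
Qed.

Lemma picard_continuous (a : R) (b : R -> R) (c : R) (u : R -> R) (t : R) :
  (forall s, continuous b s) -> (forall s, continuous u s) ->
  continuous (picard a b c u) t.
Proof.
  intros Hb Hu. apply ex_derive_continuous_R. eexists. now apply is_derive_picard.
Qed.

(* The weight [exp (K t)] makes the Picard map a contraction of ratio 1/2 on the
   whole of [[0, T]], because [L / K ^ 2 <= 1 / 2] for [L = a + B], [K = 2 L + 2]. *)
Lemma picard_bound (a : R) (b u v : R -> R) (c e B T : R) :
  0 < a -> 0 <= T -> 0 <= B -> 0 <= e ->
  (forall s, continuous b s) -> (forall s, continuous u s) -> (forall s, continuous v s) ->
  (forall t, 0 <= t <= T ->
     Rabs (force a b t (u t) - force a b t (v t)) <= (a + B) * (e * exp ((2 * (a + B) + 2) * t))) ->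
  forall t, 0 <= t <= T ->
    Rabs (picard a b c u t - picard a b c v t) <= e / 2 * exp ((2 * (a + B) + 2) * t).
Proof.
  intros Ha HT HB He Hb Hu Hv HF t Ht.
  set (L := a + B) in *. set (K := 2 * L + 2) in *.
  assert (HL : 0 < L) by (unfold L; lra).
  assert (HK : 0 < K) by (unfold K; lra).
  (* One integration compares the velocities, a second one the angles; each divides by [K]. *)
  assert (S : forall s, 0 <= s <= T ->
    Rabs (speed a b u s - speed a b v s) <= (L * e) / K * exp (K * s)).
  { apply (exp_integral_bound (fun s => speed a b u s - speed a b v s)
      (fun s => force a b s (u s) - force a b s (v s))); try assumption; [nra| |].
    - unfold speed. rewrite !RInt_point. unfold zero; simpl. ring.
    - intros s Hs. split; [|rewrite Rmult_assoc; now apply HF].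
      apply (is_derive_minus (speed a b u) (speed a b v)); now apply is_derive_speed. }
  assert (P : Rabs (picard a b c u t - picard a b c v t) <= (L * e) / K / K * exp (K * t)).
  { apply (exp_integral_bound (fun s => picard a b c u s - picard a b c v s)
      (fun s => speed a b u s - speed a b v s) _ K T); try assumption.
    - apply Rdiv_le_0_compat; nra.
    - unfold picard. ring_simplify. rewrite !RInt_point. unfold zero; simpl. ring.
    - intros s Hs. split; [|now apply S].
      apply (is_derive_minus (picard a b c u) (picard a b c v)); now apply is_derive_picard. }
  eapply Rle_trans; [exact P|]. apply Rmult_le_compat_r; [left; apply exp_pos|].
  assert (L / K / K <= 1 / 2).
  { apply (Rmult_le_reg_r (K * K)); [nra|]. replace (L / K / K * (K * K)) with L by (field; lra).
    unfold K; nra. }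
  replace (L * e / K / K) with (L / K / K * e) by (field; lra). nra.
Qed.

Fixpoint iterate (a : R) (b : R -> R) (c : R) (n : nat) : R -> R :=
  match n with
  | O => fun _ => c
  | S m => picard a b c (iterate a b c m)
  end.

Lemma iterate_continuous (a : R) (b : R -> R) (c : R) (n : nat) :
  (forall s, continuous b s) -> forall s, continuous (iterate a b c n) s.
Proof.
  intros Hb. induction n as [|n IH]; intros s; simpl.
  - apply continuous_const.
  - now apply picard_continuous.
Qed.

Lemma pow_half_small (M eps : R) : 0 <= M -> 0 < eps ->
  exists n : nat, M * (1 / 2) ^ n < eps.
Proof.
  intros HM He.
  (* Dividing by [M + 1] also covers the case [M = 0]. *)
  destruct (pow_lt_1_zero (1 / 2)) with (y := eps / (M + 1)) as [n Hn].
  - rewrite Rabs_pos_eq; lra.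
  - apply Rdiv_lt_0_compat; lra.
  - exists n. specialize (Hn n (le_n n)).
    assert (P : 0 < (1 / 2) ^ n) by (apply pow_lt; lra).
    rewrite Rabs_pos_eq in Hn by lra.
    apply (Rmult_lt_compat_l (M + 1)) in Hn; [|lra].
    replace ((M + 1) * (eps / (M + 1))) with eps in Hn by (field; lra). lra.
Qed.

(** In the norm weighted by [exp (K * t)] the gap between consecutive iterates is halved at each
    step, starting from the bound [M] on the first gap; a geometric sum does the rest. *)
Lemma iterate_close (a : R) (b : R -> R) (c T : R) : 0 < a -> 0 <= T ->
  (forall s, continuous b s) ->
  exists M, 0 <= M /\ forall t, 0 <= t <= T -> forall n m,
    Rabs (iterate a b c (n + m) t - iterate a b c n t) <= M * (1 / 2) ^ n.
Proof.
  intros Ha HT Hb.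
  destruct (continuous_bounded b T HT Hb) as [B [HB0 HB]].
  destruct (continuous_bounded
    (fun t => iterate a b c 1 t - iterate a b c 0 t) T HT) as [M [HM0 HM]].
  { intros t. apply (continuous_minus (iterate a b c 1) (iterate a b c 0));
      now apply iterate_continuous. }
  set (K := 2 * (a + B) + 2).
  assert (HK : 0 < K) by (unfold K; lra).
  assert (step : forall n t, 0 <= t <= T ->
    Rabs (iterate a b c (S n) t - iterate a b c n t) <= M * (1 / 2) ^ n * exp (K * t)).
  { induction n as [|n IH]; intros t Ht.
    - specialize (HM t Ht). cbv beta in HM.
      assert (1 <= exp (K * t)) by (rewrite <- exp_0; apply exp_le; nra).
      rewrite pow_O. nra.
    - replace (M * (1 / 2) ^ S n) with (M * (1 / 2) ^ n / 2) by (simpl; field).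
      apply (picard_bound a b (iterate a b c (S n)) (iterate a b c n) c (M * (1 / 2) ^ n) B T);
        try assumption; try (intros s; now apply iterate_continuous).
      + apply Rmult_le_pos; [exact HM0 | apply pow_le; lra].
      + intros s Hs. eapply Rle_trans; [now apply force_lipschitz, HB|].
        apply Rmult_le_compat_l; [lra | now apply IH]. }
  (* The subtracted power is the remainder of the geometric sum; keeping it makes the induction on
     [m] close. *)
  assert (sum : forall t, 0 <= t <= T -> forall n m,
    Rabs (iterate a b c (n + m) t - iterate a b c n t)
      <= 2 * M * ((1 / 2) ^ n - (1 / 2) ^ (n + m)) * exp (K * t)).
  { intros t Ht n m. induction m as [|m IH].
    - rewrite Nat.add_0_r, !Rminus_diag, Rabs_R0. lra.
    - rewrite Nat.add_succ_r. pose proof (step (n + m)%nat t Ht) as H.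
      replace (iterate a b c (S (n + m)) t - iterate a b c n t)
        with ((iterate a b c (S (n + m)) t - iterate a b c (n + m) t)
              + (iterate a b c (n + m) t - iterate a b c n t)) by ring.
      eapply Rle_trans; [apply Rabs_triang|].
      replace (2 * M * ((1 / 2) ^ n - (1 / 2) ^ S (n + m)) * exp (K * t))
        with (M * (1 / 2) ^ (n + m) * exp (K * t)
              + 2 * M * ((1 / 2) ^ n - (1 / 2) ^ (n + m)) * exp (K * t))
        by (simpl; field).
      lra. }
  exists (2 * M * exp (K * T)).
  assert (E0 : forall s, 0 < exp s) by (intros; apply exp_pos).
  split; [specialize (E0 (K * T)); nra|].
  intros t Ht n m. eapply Rle_trans; [now apply sum|].
  assert (0 < (1 / 2) ^ (n + m)) by (apply pow_lt; lra).
  assert (P : 0 < (1 / 2) ^ n) by (apply pow_lt; lra).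
  assert (exp (K * t) <= exp (K * T)) by (apply exp_le; nra).
  apply Rle_trans with (2 * M * (1 / 2) ^ n * exp (K * t)).
  - apply Rmult_le_compat_r; [left; apply E0|]. nra.
  - replace (2 * M * exp (K * T) * (1 / 2) ^ n)
      with (2 * M * (1 / 2) ^ n * exp (K * T)) by ring.
    apply Rmult_le_compat_l; nra.
Qed.

(** Time is frozen at 0 for negative arguments, where the estimates do not apply, so that the limit
    is continuous on the whole line. *)
Definition picard_limit (a : R) (b : R -> R) (c t : R) : R :=
  real (Lim_seq (fun n => iterate a b c n (Rmax 0 t))).

(** The iterates form a Cauchy sequence, so the limit is finite; letting the larger index tend to
    infinity in [iterate_close] gives a rate uniform in [t]. *)
Lemma picard_limit_close (a : R) (b : R -> R) (c T : R) : 0 < a -> 0 <= T ->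
  (forall s, continuous b s) ->
  exists M, 0 <= M /\ forall t, t <= T -> forall n,
    Rabs (picard_limit a b c t - iterate a b c n (Rmax 0 t)) <= M * (1 / 2) ^ n.
Proof.
  intros Ha HT Hb.
  destruct (iterate_close a b c T Ha HT Hb) as [M [HM0 HM]].
  exists M. split; [exact HM0|]. intros t' Ht' n. unfold picard_limit.
  assert (Ht : 0 <= Rmax 0 t' <= T)
    by (split; [apply Rmax_l | now apply Rmax_lub]).
  generalize dependent (Rmax 0 t'). intros t Ht.
  assert (C : ex_finite_lim_seq (fun n => iterate a b c n t)).
  { apply ex_lim_seq_cauchy_corr. intros eps.
    destruct (pow_half_small M (eps / 2) HM0) as [N HN]; [destruct eps; simpl; lra|].
    exists N. intros p q Hp Hq.
    pose proof (HM t Ht N (p - N)%nat) as H1. pose proof (HM t Ht N (q - N)%nat) as H2.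
    replace (N + (p - N))%nat with p in H1 by lia.
    replace (N + (q - N))%nat with q in H2 by lia.
    apply Rabs_le_between in H1. apply Rabs_le_between in H2.
    apply Rabs_lt_between. lra. }
  apply Lim_seq_correct' in C. set (l := real (Lim_seq _)) in *.
  assert (A : is_lim_seq (fun m => Rabs (iterate a b c (n + m) t - iterate a b c n t))
     (Rabs (l - iterate a b c n t))).
  { apply (is_lim_seq_abs _ (Finite _)).
    apply (is_lim_seq_minus' _ _ l (iterate a b c n t)); [|apply is_lim_seq_const].
    apply (is_lim_seq_incr_n _ n) in C.
    apply is_lim_seq_ext with (2 := C). intros k. now rewrite Nat.add_comm. }
  exact (is_lim_seq_le _ _ _ _ (HM t Ht n) A (is_lim_seq_const _)).
Qed.

Lemma continuous_Rmax0 (t : R) : continuous (Rmax 0) t.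
Proof.
  apply continuity_pt_filterlim. intros eps He. exists eps. split; [exact He|].
  intros s [_ Hs]. simpl in *. unfold Rdist in *.
  eapply Rle_lt_trans; [|exact Hs].
  unfold Rmax. destruct (Rle_dec 0 s), (Rle_dec 0 t); unfold Rabs;
    repeat destruct Rcase_abs; lra.
Qed.

Lemma picard_limit_continuous (a : R) (b : R -> R) (c t : R) : 0 < a ->
  (forall s, continuous b s) -> continuous (picard_limit a b c) t.
Proof.
  intros Ha Hb.
  (* A single constant [M] serves all points within distance 1 of [t], as the uniform limit argument
     requires. *)
  destruct (picard_limit_close a b c (Rabs t + 1) Ha) as [M [HM0 HM]];
    [pose proof (Rabs_pos t); lra | exact Hb |].
  apply continuity_pt_filterlim. intros eps He.
  destruct (pow_half_small M (eps / 3) HM0) as [n Hn]; [lra|].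
  assert (C : continuity_pt (fun s => iterate a b c n (Rmax 0 s)) t).
  { apply continuity_pt_filterlim. apply (continuous_comp (Rmax 0) (iterate a b c n)).
    - apply continuous_Rmax0.
    - now apply iterate_continuous. }
  destruct (C (eps / 3)) as [d [Hd H]]; [lra|].
  exists (Rmin d 1). split; [apply Rmin_pos; lra|].
  intros s [Hs1 Hs2]. simpl in *. unfold Rdist in *.
  assert (Ls : Rabs (s - t) < d) by (eapply Rlt_le_trans; [exact Hs2 | apply Rmin_l]).
  assert (L1 : Rabs (s - t) < 1) by (eapply Rlt_le_trans; [exact Hs2 | apply Rmin_r]).
  specialize (H s (conj Hs1 Ls)).
  assert (As : s <= Rabs t + 1)
    by (apply Rabs_lt_between in L1; pose proof (Rle_abs t); lra).
  assert (At : t <= Rabs t + 1) by (pose proof (Rle_abs t); lra).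
  pose proof (HM s As n) as H1. pose proof (HM t At n) as H2.
  apply Rabs_le_between in H1. apply Rabs_le_between in H2.
  apply Rabs_lt_between in H. apply Rabs_lt_between. lra.
Qed.

(** Both sides lie within a multiple of [(1 / 2) ^ n] of the iterate of index [S n]: the right one
    by the rate of convergence, the left one by contraction. *)
Lemma picard_limit_fixed (a : R) (b : R -> R) (c t : R) : 0 < a -> 0 <= t ->
  (forall s, continuous b s) ->
  picard a b c (picard_limit a b c) t = picard_limit a b c t.
Proof.
  intros Ha Ht Hb.
  destruct (picard_limit_close a b c t Ha Ht Hb) as [M [HM0 HM]].
  destruct (continuous_bounded b t Ht Hb) as [B [HB0 HB]].
  set (K := 2 * (a + B) + 2). set (u := picard_limit a b c) in *.
  assert (E0 : forall s, 0 < exp s) by (intros; apply exp_pos).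
  destruct (Req_dec (picard a b c u t) (u t)) as [E|N]; [exact E | exfalso].
  assert (P : 0 < Rabs (picard a b c u t - u t)) by (apply Rabs_pos_lt; lra).
  (* The factor [M * (exp (K * t) + 1)] absorbs the two distances to the iterate of index [S n]. *)
  destruct (pow_half_small (M * (exp (K * t) + 1)) (Rabs (picard a b c u t - u t))) as [n Hn];
    [specialize (E0 (K * t)); nra | exact P |].
  pose proof (HM t (Rle_refl t) (S n)) as H1. rewrite Rmax_right in H1 by exact Ht.
  assert (Pn : 0 < (1 / 2) ^ n) by (apply pow_lt; lra).
  assert (H2 : Rabs (picard a b c u t - picard a b c (iterate a b c n) t)
     <= M * (1 / 2) ^ n / 2 * exp (K * t)).
  { apply (picard_bound a b u (iterate a b c n) c (M * (1 / 2) ^ n) B t); try assumption; try lra.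
    - nra.
    - intros s. now apply picard_limit_continuous.
    - intros s. now apply iterate_continuous.
    - intros s Hs. eapply Rle_trans; [now apply force_lipschitz, HB|].
      apply Rmult_le_compat_l; [lra|].
      pose proof (HM s (proj2 Hs) n) as H. rewrite Rmax_right in H by apply Hs.
      eapply Rle_trans; [exact H|].
      assert (1 <= exp (K * s)) by (rewrite <- exp_0; apply exp_le; unfold K; nra).
      assert (0 <= M * (1 / 2) ^ n) by nra. fold K. nra. }
  simpl in H1. apply Rabs_le_between in H1. apply Rabs_le_between in H2.
  specialize (E0 (K * t)).
  assert (0 <= M * (1 / 2) ^ n) by nra.
  assert (Q : Rabs (picard a b c u t - u t) <= M * (1 / 2) ^ n * (exp (K * t) + 1)).
  { apply Rabs_le_between. nra. }
  lra.
Qed.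

(** * Motions of the lifted angle: existence, reflection, dependence on the initial angle *)

(** The equation lifted to the real line. Derivatives at time 0 are two-sided; the Picard
    construction supplies them because it runs on the whole line. *)
Definition motion (a : R) (b x p : R -> R) : Prop :=
  forall t, 0 <= t -> is_derive x t (p t) /\ is_derive p t (force a b t (x t)).

Lemma motion_exists (a : R) (b : R -> R) (c : R) : 0 < a ->
  (forall s, continuous b s) ->
  exists x p, motion a b x p /\ x 0 = c /\ p 0 = 0.
Proof.
  intros Ha Hb. set (u := picard_limit a b c).
  assert (Hu : forall s, continuous u s) by (intros s; now apply picard_limit_continuous).
  exists (picard a b c u), (speed a b u). split; [|split].
  - intros t Ht. split; [now apply is_derive_picard|].
    unfold u at 2. rewrite (picard_limit_fixed a b c t Ha Ht Hb).
    now apply is_derive_speed.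
  - unfold picard. rewrite RInt_point. apply Rplus_0_r.
  - exact (RInt_point 0 (fun s => force a b s (u s))).
Qed.

Lemma motion_continuous (a : R) (b x p : R -> R) (t : R) : motion a b x p -> 0 <= t ->
  continuous x t /\ continuous p t.
Proof.
  intros H Ht. destruct (H t Ht) as [Hx Hp].
  split; apply ex_derive_continuous_R; eexists; eassumption.
Qed.

(** Mirror symmetry of the pendulum and its pivot; it reduces every statement about [- PI / 2] to
    one about [PI / 2]. *)
Lemma motion_opp (a : R) (b x p : R -> R) : motion a b x p ->
  motion a (fun t => - b t) (fun t => - x t) (fun t => - p t).
Proof.
  intros H t Ht. destruct (H t Ht) as [Hx Hp]. split.
  - now apply (is_derive_opp x).
  - replace (force a (fun t => - b t) t (- x t)) with (- force a b t (x t))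
      by (unfold force; rewrite sin_neg, cos_neg; ring).
    now apply (is_derive_opp p).
Qed.

(** Gronwall's inequality for the squared distance in the phase plane; equal initial velocities
    leave only the angles at time 0. *)
Lemma motion_dependence (a : R) (b : R -> R) (T : R) : 0 < a -> 0 <= T ->
  (forall s, continuous b s) ->
  exists K, forall x p y q, motion a b x p -> motion a b y q -> p 0 = q 0 ->
    forall t, 0 <= t <= T -> (x t - y t) ^ 2 <= (x 0 - y 0) ^ 2 * K.
Proof.
  intros Ha HT Hb.
  destruct (continuous_bounded b T HT Hb) as [B [HB0 HB]].
  exists (exp ((1 + a + B) * T)). intros x p y q Hx Hy E t Ht.
  assert (G : (x t - y t) ^ 2 + (p t - q t) ^ 2
     <= ((x 0 - y 0) ^ 2 + (p 0 - q 0) ^ 2) * exp ((1 + a + B) * t)).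
  { apply (gronwall (fun t => (x t - y t) ^ 2 + (p t - q t) ^ 2)
      (fun t => 2 * (x t - y t) * (p t - q t)
                + 2 * (p t - q t) * (force a b t (x t) - force a b t (y t)))); [lra| |].
    - intros s Hs. apply ex_derive_continuous_R.
      destruct (Hx s (proj1 Hs)), (Hy s (proj1 Hs)).
      auto_derive. repeat split; eexists; eassumption.
    - intros s Hs. destruct (Hx s) as [Hx1 Hx2]; [lra|]. destruct (Hy s) as [Hy1 Hy2]; [lra|].
      split.
      + auto_derive; [repeat split; eexists; eassumption|].
        rewrite (is_derive_unique (fun s : R => x s) s _ Hx1), (is_derive_unique (fun s : R => y s) s _ Hy1),
          (is_derive_unique (fun s : R => p s) s _ Hx2), (is_derive_unique (fun s : R => q s) s _ Hy2).
        ring.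
      + assert (F := force_lipschitz a B b s (x s) (y s) Ha (HB s ltac:(lra))).
        revert F. generalize (force a b s (x s) - force a b s (y s)).
        generalize (x s - y s). generalize (p s - q s). intros v u w F.
        (* The derivative is [2 * u * v + 2 * v * w] with [w] at most [(a + B) * Rabs u] in absolute
           value, hence at most [1 + a + B] times the squared distance. *)
        assert (2 * u * v <= u ^ 2 + v ^ 2) by (pose proof (pow2_ge_0 (u - v)); nra).
        assert (V : v * w <= Rabs v * ((a + B) * Rabs u)).
        { eapply Rle_trans; [apply Rle_abs|]. rewrite Rabs_mult.
          apply Rmult_le_compat_l; [apply Rabs_pos | exact F]. }
        assert (2 * (Rabs v * Rabs u) <= u ^ 2 + v ^ 2).
        { rewrite <- (pow2_abs u), <- (pow2_abs v).
          pose proof (pow2_ge_0 (Rabs u - Rabs v)). nra. }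
        nra. }
  rewrite E, Rminus_diag in G.
  assert (exp ((1 + a + B) * t) <= exp ((1 + a + B) * T)) by (apply exp_le; nra).
  pose proof (pow2_ge_0 (p t - q t)). pose proof (pow2_ge_0 (x 0 - y 0)).
  apply Rle_trans with ((x 0 - y 0) ^ 2 * exp ((1 + a + B) * t)); nra.
Qed.

(** * Motions leaving the upper arc *)

(** The inequalities are strict and the time interval is compact, which makes the condition stable
    under small changes of the initial angle. *)
Definition escapes (x : R -> R) : Prop :=
  exists t, 0 <= t /\ PI / 2 < x t /\ forall s, 0 <= s <= t -> - (PI / 2) < x s.

Lemma escapes_disjoint (x : R -> R) : escapes x -> escapes (fun t => - x t) -> False.
Proof.
  intros [t [Ht [H1 H2]]] [s [Hs [H3 H4]]].
  destruct (Rle_dec t s).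
  - specialize (H4 t). lra.
  - specialize (H2 s). lra.
Qed.

Lemma continuous_pos_near (h : R -> R) (t : R) : continuous h t -> 0 < h t ->
  exists d, 0 < d /\ forall s, Rabs (s - t) < d -> 0 < h s.
Proof.
  intros Hc Hp.
  assert (L : locally t (fun s => 0 < h s)) by (apply Hc; now apply open_gt).
  destruct L as [d Hd]. exists d. split; [apply cond_pos | exact Hd].
Qed.

(** The acceleration stays positive shortly after [t]; the mean value theorem, used twice, makes the
    velocity positive and then pushes the angle beyond [PI / 2]. *)
Lemma escapes_of_touch (a : R) (b x p : R -> R) (t : R) : 0 < a ->
  (forall s, continuous b s) -> motion a b x p ->
  0 <= t -> x t = PI / 2 -> 0 <= p t ->
  (forall s, 0 <= s <= t -> - (PI / 2) < x s) -> escapes x.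
Proof.
  intros Ha Hb Hm Ht Hx Hp Hup.
  assert (F : 0 < force a b t (x t)).
  { unfold force. rewrite Hx, sin_PI2, cos_PI2. lra. }
  destruct (motion_continuous a b x p t Hm Ht) as [Cx _].
  destruct (continuous_pos_near (fun s => force a b s (x s)) t) as [d [Hd0 Hd]];
    [now apply force_continuous | exact F |].
  assert (Hp' : forall s, t < s < t + d -> 0 < p s).
  { intros s Hs. destruct (MVT_gen p t s (fun s => force a b s (x s))) as [r [Hr E]].
    - rewrite Rmin_left, Rmax_right by lra. intros r Hr. apply Hm. lra.
    - rewrite Rmin_left, Rmax_right by lra. intros r Hr. apply continuity_pt_filterlim.
      apply (motion_continuous a b x p r Hm). lra.
    - rewrite Rmin_left, Rmax_right in Hr by lra.
      assert (0 < force a b r (x r)) by (apply Hd, Rabs_lt_between; lra).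
      nra. }
  assert (Hx' : forall s, t < s < t + d -> PI / 2 < x s).
  { intros s Hs.
    destruct (MVT_cor2 x p t s) as [r [E Hr]]; [lra| |].
    - intros r Hr. apply is_derive_Reals, Hm. lra.
    - assert (0 < p r) by (apply Hp'; lra). nra. }
  exists (t + d / 2). split; [lra|]. split; [apply Hx'; lra|].
  intros s Hs. destruct (Rle_dec s t); [apply Hup; lra|].
  assert (PI / 2 < x s) by (apply Hx'; lra). pose proof PI_RGT_0. lra.
Qed.

(** The zero is the supremum [r] of the times before which [h] is positive. By continuity, a
    negative value at [r] would spread to earlier times and a positive one would push the supremum
    further. *)
Lemma first_zero (h : R -> R) (t : R) : 0 <= t -> (forall s, 0 <= s -> continuous h s) ->
  0 <= h 0 -> h t <= 0 ->
  exists r, 0 <= r <= t /\ h r = 0 /\ forall s, 0 <= s < r -> 0 < h s.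
Proof.
  intros Ht Hc H0 H1.
  destruct (completeness (fun r => 0 <= r <= t /\ forall s, 0 <= s < r -> 0 < h s)) as [r [Hub Hlub]].
  - exists t. intros r [Hr _]. lra.
  - exists 0. split; [lra|]. intros; lra.
  - assert (Hr0 : 0 <= r) by (apply Hub; split; [lra | intros; lra]).
    assert (Hrt : r <= t) by (apply Hlub; intros s [Hs _]; lra).
    assert (Hpos : forall s, 0 <= s < r -> 0 < h s).
    { intros s Hs. destruct (Rlt_dec 0 (h s)) as [P|N]; [exact P|exfalso].
      assert (r <= s); [|lra]. apply Hlub. intros q [Hq1 Hq2].
      destruct (Rle_dec q s) as [Q|Q]; [exact Q|]. exfalso. apply N, Hq2. lra. }
    exists r. split; [lra|]. split; [|exact Hpos].
    destruct (Rtotal_order (h r) 0) as [N|[Z|P]]; [exfalso|exact Z|exfalso].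
    + assert (r <> 0) by (intros ->; lra).
      destruct (continuous_pos_near (fun s => - h s) r) as [d [Hd0 Hd]]; [|lra|].
      * apply (continuous_opp h). apply Hc, Hr0.
      * assert (Hm : 0 < Rmin d r) by (apply Rmin_pos; lra).
        pose proof (Rmin_l d r). pose proof (Rmin_r d r).
        set (s := r - Rmin d r / 2).
        assert (0 < - h s) by (apply Hd, Rabs_lt_between; unfold s; lra).
        assert (0 < h s) by (apply Hpos; unfold s; lra). lra.
    + destruct (continuous_pos_near h r (Hc r Hr0) P) as [d [Hd0 Hd]].
      assert (r <> t) by (intros ->; lra).
      assert (Hm : 0 < Rmin d (t - r)) by (apply Rmin_pos; lra).
      pose proof (Rmin_l d (t - r)). pose proof (Rmin_r d (t - r)).
      assert (r + Rmin d (t - r) / 2 <= r); [|lra].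
      apply Hub. split; [lra|]. intros s Hs.
      destruct (Rlt_dec s r); [apply Hpos; lra|].
      apply Hd, Rabs_lt_between. lra.
Qed.

Lemma derive_left_nonneg (x : R -> R) (t v : R) : 0 < t -> is_derive x t v ->
  (forall s, 0 <= s < t -> x s <= x t) -> 0 <= v.
Proof.
  intros Ht Hx Hs. destruct (Rle_dec 0 v) as [P|N]; [exact P | exfalso].
  apply is_derive_Reals in Hx.
  (* With tolerance [- v] the difference quotients would be negative, whereas those from the left
     are nonnegative. *)
  destruct (Hx (- v)) as [[d Hd0] Hd]; [lra|]. simpl in Hd.
  assert (Hm : 0 < Rmin d t) by (apply Rmin_pos; lra).
  pose proof (Rmin_l d t). pose proof (Rmin_r d t).
  set (k := - (Rmin d t / 2)).
  specialize (Hd k ltac:(unfold k; lra) ltac:(apply Rabs_lt_between; unfold k; lra)).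
  apply Rabs_lt_between in Hd.
  assert (Hk : x (t + k) <= x t) by (apply Hs; unfold k; lra).
  assert (0 <= (x (t + k) - x t) / k); [|lra].
  replace ((x (t + k) - x t) / k) with ((x t - x (t + k)) / - k) by (field; unfold k; lra).
  apply Rdiv_le_0_compat; unfold k in *; lra.
Qed.

(** At the first horizontal position the velocity points outwards or vanishes, since the motion
    arrives from inside the arc or starts there at rest; [escapes_of_touch] then applies. *)
Lemma escapes_of_exit (a : R) (b x p : R -> R) (t : R) : 0 < a ->
  (forall s, continuous b s) -> motion a b x p -> p 0 = 0 ->
  - (PI / 2) <= x 0 <= PI / 2 ->
  0 <= t -> ~ (- (PI / 2) < x t < PI / 2) ->
  escapes x \/ escapes (fun s => - x s).
Proof.
  intros Ha Hb Hm Hp0 Hx0 Ht Hout. pose proof PI_RGT_0 as HPI.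
  (* Stated for an arbitrary [b'] so that it also serves the reflected motion. *)
  assert (touch : forall b' y q r, (forall s, continuous b' s) -> motion a b' y q -> q 0 = 0 ->
    0 <= r -> y r = PI / 2 -> (forall s, 0 <= s < r -> - (PI / 2) < y s < PI / 2) -> escapes y).
  { intros b' y q r Hb' Hy Hq Hr Hyr Hin.
    apply (escapes_of_touch a b' y q r); try assumption.
    - destruct (Req_dec r 0) as [->|N]; [lra|].
      apply (derive_left_nonneg y r); [lra | now apply Hy |].
      intros s Hs. specialize (Hin s Hs). lra.
    - intros s Hs. destruct (Req_dec s r) as [->|N]; [lra|]. apply Hin. lra. }
  (* This function vanishes exactly at the two horizontal positions, so one search finds the first
     of either. *)
  destruct (first_zero (fun s => (PI / 2) ^ 2 - (x s) ^ 2) t Ht) as [r [Hr [Er Hin]]].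
  - intros s Hs. apply ex_derive_continuous_R.
    auto_derive. eexists. now apply Hm.
  - nra.
  - nra.
  - assert (Hin' : forall s, 0 <= s < r -> - (PI / 2) < x s < PI / 2).
    { intros s Hs. specialize (Hin s Hs). cbv beta in Hin. split; nra. }
    destruct (Rmult_integral (PI / 2 - x r) (PI / 2 + x r)) as [E|E]; [nra| |].
    + left. apply (touch b x p r); try assumption; lra.
    + right. apply (touch (fun t => - b t) (fun t => - x t) (fun t => - p t) r); try lra.
      * intros s. apply (continuous_opp b), Hb.
      * now apply motion_opp.
      * intros s Hs. specialize (Hin' s Hs). lra.
Qed.

Lemma escapes_open (a : R) (b x p : R -> R) : 0 < a ->
  (forall s, continuous b s) -> motion a b x p -> p 0 = 0 -> escapes x ->
  exists d, 0 < d /\ forall y q, motion a b y q -> q 0 = 0 ->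
    Rabs (y 0 - x 0) < d -> escapes y.
Proof.
  intros Ha Hb Hm Hp [t [Ht [Hx Hup]]].
  destruct (motion_dependence a b t Ha Ht Hb) as [K HK].
  destruct (continuity_ab_min x 0 t Ht) as [m [Hmin Hm0]].
  { intros s Hs. apply continuity_pt_filterlim.
    apply (motion_continuous a b x p s Hm). lra. }
  (* The margin [e] is the smaller of the overshoot at time [t] and the least clearance above
     [- PI / 2] up to then. *)
  set (e := Rmin (x t - PI / 2) (x m + PI / 2)).
  assert (He : 0 < e).
  { apply Rmin_pos; [lra|]. specialize (Hup m Hm0). lra. }
  assert (e <= x t - PI / 2) by apply Rmin_l.
  assert (e <= x m + PI / 2) by apply Rmin_r.
  assert (HK1 : 0 < Rabs K + 1) by (pose proof (Rabs_pos K); lra).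
  exists (e / (Rabs K + 1)). split; [apply Rdiv_lt_0_compat; lra|].
  intros y q Hy Hq Hd.
  assert (near : forall s, 0 <= s <= t -> Rabs (x s - y s) < e).
  { intros s Hs. specialize (HK x p y q Hm Hy ltac:(lra) s Hs).
    assert (Hd' : Rabs (y 0 - x 0) * (Rabs K + 1) < e).
    { apply (Rmult_lt_compat_r (Rabs K + 1)) in Hd; [|exact HK1].
      replace (e / (Rabs K + 1) * (Rabs K + 1)) with e in Hd by (field; lra). exact Hd. }
    (* As [K] is at most [(Rabs K + 1) ^ 2], the estimate becomes a comparison of squares. *)
    assert (HK2 : (x s - y s) ^ 2 <= (Rabs (y 0 - x 0) * (Rabs K + 1)) ^ 2).
    { eapply Rle_trans; [exact HK|].
      rewrite Rpow_mult_distr, pow2_abs.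
      replace ((y 0 - x 0) ^ 2) with ((x 0 - y 0) ^ 2) by ring.
      apply Rmult_le_compat_l; [apply pow2_ge_0|].
      pose proof (Rle_abs K). pose proof (Rabs_pos K). nra. }
    assert (0 <= Rabs (y 0 - x 0) * (Rabs K + 1))
      by (apply Rmult_le_pos; [apply Rabs_pos | lra]).
    apply Rabs_lt_between. split; nra. }
  exists t. split; [exact Ht|]. split.
  - specialize (near t ltac:(lra)). apply Rabs_lt_between in near. lra.
  - intros s Hs. specialize (near s Hs). apply Rabs_lt_between in near.
    specialize (Hmin s Hs). lra.
Qed.

(** * The initial angle at the boundary of downward escape *)

Lemma motion_trapped (a : R) (b : R -> R) : 0 < a -> (forall s, continuous b s) ->
  exists x p, motion a b x p /\ p 0 = 0 /\
    forall t, 0 <= t -> - (PI / 2) < x t < PI / 2.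
Proof.
  intros Ha Hb. pose proof PI_RGT_0 as HPI.
  set (b' := fun t => - b t).
  assert (Hb' : forall s, continuous b' s) by (intros s; apply (continuous_opp b), Hb).
  (* Some motion from [c] escapes downwards; [escapes_open] speaks of all motions starting nearby,
     so the two combine. *)
  set (down := fun c => exists x p, motion a b x p /\ x 0 = c /\ p 0 = 0 /\ escapes (fun t => - x t)).
  assert (Hlow : down (- (PI / 2))).
  { destruct (motion_exists a b (- (PI / 2)) Ha Hb) as [x [p [Hm [Hx Hp]]]].
    exists x, p. refine (conj Hm (conj Hx (conj Hp _))).
    apply (escapes_of_touch a b' (fun t => - x t) (fun t => - p t) 0); try lra.
    - exact Hb'.
    - now apply motion_opp.
    - intros s Hs. replace s with 0 by lra. lra. }
  destruct (completeness (fun c => - (PI / 2) <= c <= PI / 2 /\ down c)) as [m [Hub Hlub]].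
  - exists (PI / 2). intros c [Hc _]. lra.
  - exists (- (PI / 2)). split; [lra | exact Hlow].
  - assert (Hm1 : m <= PI / 2) by (apply Hlub; intros c [Hc _]; lra).
    assert (Hm2 : - (PI / 2) <= m) by (apply Hub; split; [lra | exact Hlow]).
    destruct (motion_exists a b m Ha Hb) as [x [p [Hm [Hx Hp]]]].
    assert (Hup : escapes x -> False).
    { intros He. destruct (escapes_open a b x p Ha Hb Hm Hp He) as [d [Hd0 Hd]].
      (* Angles within [d] of [m] escape upwards, hence not downwards, so [m - d / 2] would be a
         smaller upper bound. *)
      assert (m <= m - d / 2); [|lra]. apply Hlub. intros c [Hc Hdown].
      destruct (Rle_dec c (m - d / 2)) as [Q|Q]; [exact Q | exfalso].
      assert (c <= m) by (apply Hub; now split).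
      destruct Hdown as [y [q [Hy [Hy0 [Hq Hesc]]]]].
      apply (escapes_disjoint y); [|exact Hesc].
      apply (Hd y q Hy Hq). rewrite Hy0, Hx. apply Rabs_lt_between. lra. }
    assert (Hdn : escapes (fun t => - x t) -> False).
    { intros He.
      destruct (escapes_open a b' (fun t => - x t) (fun t => - p t) Ha Hb'
        (motion_opp a b x p Hm) ltac:(lra) He) as [d [Hd0 Hd]].
      (* At [m = PI / 2] the motion already touches the upper horizontal at time 0; below it, a
         slightly larger angle [c] would also escape downwards. *)
      destruct (Req_dec m (PI / 2)) as [E|N].
      - apply Hup. apply (escapes_of_touch a b x p 0); try assumption; try lra.
        intros s Hs. replace s with 0 by lra. lra.
      - assert (Hr : 0 < Rmin d (PI / 2 - m)) by (apply Rmin_pos; lra).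
        pose proof (Rmin_l d (PI / 2 - m)). pose proof (Rmin_r d (PI / 2 - m)).
        set (c := m + Rmin d (PI / 2 - m) / 2).
        destruct (motion_exists a b c Ha Hb) as [y [q [Hy [Hy0 Hq]]]].
        assert (c <= m); [|unfold c in *; lra]. apply Hub. split; [unfold c; lra|].
        exists y, q. refine (conj Hy (conj Hy0 (conj Hq _))).
        apply (Hd (fun t => - y t) (fun t => - q t) (motion_opp a b y q Hy)); [lra|].
        rewrite Hy0, Hx. apply Rabs_lt_between. unfold c; lra. }
    exists x, p. refine (conj Hm (conj Hp _)). intros t Ht. apply NNPP. intros Q.
    destruct (escapes_of_exit a b x p t Ha Hb Hm Hp); try lra; auto.
Qed.

(** * Uniqueness on the circle *)

(** A pointwise choice of representative, with no continuity in time; it is therefore only observed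
    through its sine and cosine. *)
Definition lift (A : angle) : R :=
  proj1_sig (constructive_indefinite_description _ (ang_surj A)).

Lemma ang_lift (A : angle) : A = ang (lift A).
Proof.
  unfold lift. exact (proj2_sig (constructive_indefinite_description _ (ang_surj A))).
Qed.

Lemma sin_cos_ang (x y : R) : ang x = ang y -> sin x = sin y /\ cos x = cos y.
Proof.
  intros E. apply ang_eq in E. destruct E as [k ->].
  (* The periodicity lemmas count turns by a natural number, so for negative [k] the turns are added
     to the other angle. *)
  destruct (Z_le_gt_dec 0 k) as [K|K].
  - replace (x + 2 * PI * IZR k) with (x + 2 * INR (Z.to_nat k) * PI)
      by (rewrite INR_IZR_INZ, Z2Nat.id by lia; ring).
    now rewrite sin_period, cos_period.
  - set (y := x + 2 * PI * IZR k).
    replace x with (y + 2 * INR (Z.to_nat (- k)) * PI)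
      by (unfold y; rewrite INR_IZR_INZ, Z2Nat.id, opp_IZR by lia; ring).
    now rewrite sin_period, cos_period.
Qed.

(** The hypotheses give [cos (y - x) = 1]; by the half-angle formula [(y - x) / 2] is a zero of the
    sine, that is, a multiple of [PI]. *)
Lemma ang_of_sin_cos (x y : R) : sin x = sin y -> cos x = cos y -> ang x = ang y.
Proof.
  intros Es Ec. apply ang_eq.
  assert (H : sin ((y - x) / 2) = 0).
  { assert (C : cos (y - x) = 1).
    { rewrite cos_minus, Es, Ec. pose proof (sin2_cos2 y) as H. unfold Rsqr in H. lra. }
    replace (y - x) with (2 * ((y - x) / 2)) in C by field.
    rewrite cos_2a_sin in C. nra. }
  destruct (sin_eq_0_0 _ H) as [k Hk]. exists k. lra.
Qed.

(** Freezing the argument at 0 extends a ray function to the line. Continuity survives at 0, the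
    two-sided derivative only at positive times. *)
Lemma is_derive_ray_Rmax0 (h : R -> R) (t d : R) : 0 <= t -> is_derive_ray h t d ->
  continuous (fun s => h (Rmax 0 s)) t /\
  (0 < t -> is_derive (fun s => h (Rmax 0 s)) t d).
Proof.
  intros Ht H'. assert (H := proj1 (is_derive_rayE h t d Ht) H'). split.
  - apply continuity_pt_filterlim. intros eps He.
    destruct (H 1 Rlt_0_1) as [r [Hr0 Hr]].
    set (M := Rabs d + 1). assert (HM : 0 < M) by (unfold M; pose proof (Rabs_pos d); lra).
    exists (Rmin r (eps / M)). split; [apply Rmin_pos; [lra | now apply Rdiv_lt_0_compat]|].
    intros s [_ Hs]. simpl in *. unfold Rdist in *. rewrite (Rmax_right 0 t) by exact Ht.
    (* Clamping does not increase the distance to a nonnegative [t]. *)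
    assert (Ls : Rabs (Rmax 0 s - t) <= Rabs (s - t)).
    { unfold Rmax. destruct (Rle_dec 0 s); [lra|].
      unfold Rabs; repeat destruct Rcase_abs; lra. }
    pose proof (Rmin_l r (eps / M)). pose proof (Rmin_r r (eps / M)).
    specialize (Hr (Rmax 0 s) (Rmax_l 0 s) ltac:(lra)).
    set (w := Rmax 0 s - t) in *.
    assert (Hw : Rabs w * M < eps).
    { assert (Q : Rabs w < eps / M) by lra.
      apply (Rmult_lt_compat_r M) in Q; [|exact HM].
      replace (eps / M * M) with eps in Q by (field; lra). exact Q. }
    replace (h (Rmax 0 s) - h t) with ((h (Rmax 0 s) - h t - w * d) + w * d) by ring.
    eapply Rle_lt_trans; [apply Rabs_triang|]. rewrite Rabs_mult. unfold M in Hw. lra.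
  - intros Ht'. apply is_derive_Reals. intros eps He.
    destruct (H (eps / 2)) as [r [Hr0 Hr]]; [lra|].
    assert (Hm : 0 < Rmin r t) by (apply Rmin_pos; lra).
    exists (mkposreal _ Hm). simpl. intros k Hk Hkr.
    pose proof (Rmin_l r t). pose proof (Rmin_r r t).
    assert (B := Hkr). apply Rabs_lt_between in B.
    rewrite !Rmax_right by lra.
    specialize (Hr (t + k) ltac:(lra)). replace (t + k - t) with k in Hr by ring.
    specialize (Hr ltac:(lra)).
    assert (Pk : 0 < Rabs k) by now apply Rabs_pos_lt.
    replace ((h (t + k) - h t) / k - d) with ((h (t + k) - h t - k * d) / k) by (field; exact Hk).
    unfold Rdiv. rewrite Rabs_mult, Rabs_inv.
    apply (Rmult_lt_reg_r (Rabs k)); [exact Pk|].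
    rewrite Rmult_assoc, Rinv_l by lra. nra.
Qed.

(** Since [h] depends only on the angle, it takes the same values along [lift] as along the local
    lift [theta], where the chain rule applies. *)
Lemma velocity_comp (h dh : R -> R) (phi : R -> angle) (t v : R) :
  (forall x, is_derive h x (dh x)) ->
  (forall x y, ang x = ang y -> h x = h y /\ dh x = dh y) ->
  0 <= t -> is_velocity_ray phi t v ->
  continuous (fun s => h (lift (phi (Rmax 0 s)))) t /\
  (0 < t -> is_derive (fun s => h (lift (phi (Rmax 0 s)))) t (v * dh (lift (phi (Rmax 0 t))))).
Proof.
  intros Hh Hper Ht [theta [Hloc Hth]].
  destruct (is_derive_ray_Rmax0 theta t v Ht Hth) as [Hc Hd].
  assert (L : locally t (fun s => h (theta (Rmax 0 s)) = h (lift (phi (Rmax 0 s))))).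
  { assert (C := continuous_Rmax0 t). unfold continuous in C.
    rewrite (Rmax_right 0 t) in C by exact Ht.
    specialize (C _ Hloc). unfold filtermap in C.
    destruct C as [r Hr]. exists r. intros s Hs. specialize (Hr s Hs).
    apply Hper. rewrite <- ang_lift. symmetry. apply Hr, Rmax_l. }
  split.
  - apply (continuous_ext_loc _ (fun s => h (theta (Rmax 0 s)))); [exact L|].
    apply (continuous_comp (fun s => theta (Rmax 0 s)) h); [exact Hc|].
    apply ex_derive_continuous_R. eexists. apply Hh.
  - intros Ht'. apply (is_derive_ext_loc _ _ _ _ L).
    replace (dh (lift (phi (Rmax 0 t)))) with (dh (theta (Rmax 0 t))).
    + apply (is_derive_comp h (fun s => theta (Rmax 0 s))); [apply Hh | now apply Hd].
    + apply Hper. rewrite <- ang_lift. symmetry.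
      rewrite Rmax_right by exact Ht.
      destruct Hloc as [r Hr]. apply Hr; [apply ball_center | exact Ht].
Qed.

(* Circle-valued solutions are compared with a lifted motion through the chordal
   energy [(sin - sin)^2 + (cos - cos)^2 + (p - q)^2], so no global lift of [phi]
   is needed. *)
Lemma solution_unique (l g : R) (f : R -> R) (b : R -> R)
  (phi : R -> angle) (p x q : R -> R) :
  0 < l -> 0 < g -> (forall s, continuous b s) ->
  (forall t, 0 <= t -> b t = Derive_ray_n 2 f t / l) ->
  pendulum_solution l g f phi p -> motion (g / l) b x q ->
  phi 0 = ang (x 0) -> p 0 = q 0 ->
  forall t, 0 <= t -> phi t = ang (x t).
Proof.
  intros Hl Hg Hb Eb Hsol Hm E0 Ep T HT.
  set (a := g / l). assert (Ha : 0 < a) by now apply Rdiv_lt_0_compat.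
  destruct (continuous_bounded b T HT Hb) as [B [HB0 HB]].
  set (Sn := fun s => sin (lift (phi (Rmax 0 s)))).
  set (Cs := fun s => cos (lift (phi (Rmax 0 s)))).
  set (P := fun s => p (Rmax 0 s)).
  assert (HS : forall t, 0 <= t -> continuous Sn t /\ (0 < t -> is_derive Sn t (P t * Cs t))).
  { intros t Ht. unfold P. rewrite (Rmax_right 0 t Ht).
    apply (velocity_comp sin cos phi t (p t)); [| exact sin_cos_ang | exact Ht | apply Hsol, Ht].
    intros y. auto_derive; [exact I | ring]. }
  assert (HC : forall t, 0 <= t -> continuous Cs t /\ (0 < t -> is_derive Cs t (P t * - Sn t))).
  { intros t Ht. unfold P. rewrite (Rmax_right 0 t Ht).
    apply (velocity_comp cos (fun y => - sin y) phi t (p t)); [| | exact Ht | apply Hsol, Ht].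
    - intros y. auto_derive; [exact I | ring].
    - intros y z E. destruct (sin_cos_ang y z E) as [-> ->]. now split. }
  assert (HP : forall t, 0 <= t ->
    continuous P t /\ (0 < t -> is_derive P t (a * Sn t - b t * Cs t))).
  { intros t Ht. apply is_derive_ray_Rmax0; [exact Ht|].
    destruct (Hsol t Ht) as [_ H]. unfold Sn, Cs. rewrite (Rmax_right 0 t Ht), (Eb t Ht).
    apply H, ang_lift. }
  set (D := fun s => (Sn s - sin (x s)) ^ 2 + (Cs s - cos (x s)) ^ 2 + (P s - q s) ^ 2).
  assert (G : D T <= D 0 * exp (2 * (1 + a + B) * T)).
  { apply (gronwall D
      (fun t => 2 * (P t - q t) * ((a + cos (x t)) * (Sn t - sin (x t))
                                   - (b t + sin (x t)) * (Cs t - cos (x t))))); [exact HT| |].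
    - intros t Ht. destruct (HS t (proj1 Ht)) as [S1 _], (HC t (proj1 Ht)) as [C1 _],
        (HP t (proj1 Ht)) as [P1 _], (motion_continuous _ b x q t Hm (proj1 Ht)) as [X1 Q1].
      assert (sq : forall u v : R -> R, continuous u t -> continuous v t ->
        continuous (fun s => (u s - v s) ^ 2) t).
      { intros u v Cu Cv. apply (continuous_comp (fun s => u s - v s) (fun y => y ^ 2)).
        - now apply (continuous_minus u v).
        - apply ex_derive_continuous_R. auto_derive. exact I. }
      apply (continuous_plus (fun s => (Sn s - sin (x s)) ^ 2 + (Cs s - cos (x s)) ^ 2)
        (fun s => (P s - q s) ^ 2)); [|now apply sq].
      apply (continuous_plus (fun s => (Sn s - sin (x s)) ^ 2)
        (fun s => (Cs s - cos (x s)) ^ 2)); apply sq; try assumption.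
      + apply (continuous_comp x sin); [exact X1|].
        apply ex_derive_continuous_R. auto_derive. exact I.
      + apply (continuous_comp x cos); [exact X1|].
        apply ex_derive_continuous_R. auto_derive. exact I.
    - intros t Ht. destruct (HS t) as [_ S1], (HC t) as [_ C1], (HP t) as [_ P1],
        (Hm t) as [X1 Q1]; try lra.
      specialize (S1 (proj1 Ht)). specialize (C1 (proj1 Ht)). specialize (P1 (proj1 Ht)).
      split.
      + unfold D. auto_derive; [repeat split; eexists; eassumption|].
        rewrite (is_derive_unique (fun s : R => Sn s) t _ S1), (is_derive_unique (fun s : R => Cs s) t _ C1),
          (is_derive_unique (fun s : R => P s) t _ P1), (is_derive_unique (fun s : R => x s) t _ X1),
          (is_derive_unique (fun s : R => q s) t _ Q1).
        unfold force. fold a. ring.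
      + unfold D.
        assert (Bs := SIN_bound (x t)). assert (Bc := COS_bound (x t)).
        assert (Bb := proj1 (Rabs_le_between _ _) (HB t ltac:(lra))).
        generalize dependent (cos (x t)). generalize dependent (sin (x t)). intros sx Bs cx Bc.
        generalize (Sn t - sx) (Cs t - cx) (P t - q t). intros u v w.
        (* Both coefficients are at most [1 + a + B] in absolute value; the two estimates add up to
           at most [2 * (1 + a + B)] times the energy. *)
        assert (A1 : 2 * w * ((a + cx) * u) <= (1 + a + B) * (w ^ 2 + u ^ 2)).
        { pose proof (pow2_ge_0 (w + u)). pose proof (pow2_ge_0 (w - u)).
          assert (- (1 + a + B) <= a + cx <= 1 + a + B) by lra. nra. }
        assert (A2 : - (2 * w * ((b t + sx) * v)) <= (1 + a + B) * (w ^ 2 + v ^ 2)).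
        { pose proof (pow2_ge_0 (w + v)). pose proof (pow2_ge_0 (w - v)).
          assert (- (1 + a + B) <= b t + sx <= 1 + a + B) by lra. nra. }
        pose proof (pow2_ge_0 u). pose proof (pow2_ge_0 v). nra. }
  assert (D0 : D 0 = 0).
  { unfold D, Sn, Cs, P. rewrite (Rmax_right 0 0) by lra.
    destruct (sin_cos_ang (lift (phi 0)) (x 0)) as [-> ->];
      [rewrite <- ang_lift; exact E0|]. rewrite Ep. ring. }
  rewrite D0, Rmult_0_l in G. unfold D, Sn, Cs, P in G.
  rewrite (Rmax_right 0 T HT) in G.
  rewrite (ang_lift (phi T)).
  pose proof (pow2_ge_0 (sin (lift (phi T)) - sin (x T))).
  pose proof (pow2_ge_0 (cos (lift (phi T)) - cos (x T))).
  pose proof (pow2_ge_0 (p T - q T)).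
  apply ang_of_sin_cos; apply Rminus_diag_uniq, Rsqr_0_uniq; unfold Rsqr; nra.
Qed.

(** * Transfer to the circle and conclusion *)

Lemma is_derive_is_derive_ray (h : R -> R) (t d : R) : 0 <= t ->
  is_derive h t d -> is_derive_ray h t d.
Proof.
  intros Ht [_ H]. apply is_derive_rayE; [exact Ht|]. intros eps He.
  destruct (H t (fun P HP => HP) (mkposreal eps He)) as [r Hr].
  exists r. split; [apply cond_pos|]. intros s _ Hs. exact (Hr s Hs).
Qed.

Lemma motion_pendulum_solution (l g : R) (f b x p : R -> R) :
  (forall t, 0 <= t -> b t = Derive_ray_n 2 f t / l) ->
  motion (g / l) b x p -> pendulum_solution l g f (fun t => ang (x t)) p.
Proof.
  intros Eb Hm t Ht. destruct (Hm t Ht) as [Hx Hp]. split.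
  - exists x. split; [|now apply (is_derive_is_derive_ray _ _ _ Ht)].
    apply filter_forall. reflexivity.
  - intros y Hy. destruct (sin_cos_ang (x t) y Hy) as [<- <-].
    rewrite <- Eb by exact Ht. now apply (is_derive_is_derive_ray _ _ _ Ht).
Qed.

(** The existence clause keeps the clause on all solutions from being vacuous. *)
Theorem theorem2p1 (l g : R) (f : R -> R)
  (hl : 0 < l) (hg : 0 < g) (hf : smooth_ray f) :
  exists phi0 : R, - (PI / 2) < phi0 < PI / 2 /\
    (exists (phi : R -> angle) (p : R -> R),
       pendulum_solution l g f phi p /\ phi 0 = ang phi0 /\ p 0 = 0) /\
    (forall (phi : R -> angle) (p : R -> R),
       pendulum_solution l g f phi p -> phi 0 = ang phi0 -> p 0 = 0 ->
       forall t : R, 0 <= t -> upper_arc (phi t)).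
Proof.
  (* The forcing is continued to negative times by its value at 0, which makes it continuous on the
     whole line. *)
  set (b := fun t => Derive_ray_n 2 f (Rmax 0 t) / l).
  assert (Hb : forall s, continuous b s).
  { intros s. destruct (hf 2%nat (Rmax 0 s) (Rmax_l 0 s)) as [d Hd].
    destruct (is_derive_ray_Rmax0 _ _ _ (Rmax_l 0 s) Hd) as [Hc _].
    (* Continuity is known at the clamped point [Rmax 0 s]; clamping twice writes [b] as a
       composition that passes through this point. *)
    apply (continuous_ext (fun r => (Derive_ray_n 2 f (Rmax 0 (Rmax 0 r))) * / l)).
    { intros r. unfold b. now rewrite (Rmax_right 0 (Rmax 0 r)) by apply Rmax_l. }
    apply (continuous_mult (fun r => Derive_ray_n 2 f (Rmax 0 (Rmax 0 r))) (fun _ => / l));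
      [|apply continuous_const].
    apply (continuous_comp (Rmax 0) (fun r => Derive_ray_n 2 f (Rmax 0 r))); [|exact Hc].
    apply continuous_Rmax0. }
  assert (Eb : forall t, 0 <= t -> b t = Derive_ray_n 2 f t / l)
    by (intros t Ht; unfold b; now rewrite Rmax_right).
  destruct (motion_trapped (g / l) b) as [x [q [Hm [Hq Hx]]]];
    [now apply Rdiv_lt_0_compat | exact Hb |].
  exists (x 0). split; [apply Hx; lra|]. split.
  - exists (fun t => ang (x t)), q.
    split; [now apply (motion_pendulum_solution l g f b) | now split].
  - intros phi p Hsol Hphi Hp t Ht. exists (x t). split; [now apply Hx|].
    apply (solution_unique l g f b phi p x q); try assumption. now rewrite Hp.
Qed.
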